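(* Let $(S,+,* )$ be a ringoid whose multiplication $*$ is associative and commutative. If $(S,+,* )$ is ideal-simple, then one of the following holds: (i) $|S*S|=1$, where $S*S=\{a*b\mid a,b\in S\}$; (ii) $(S,* )$ is a group; (iii) there is an absorbing element $o$ in $(S,* )$ such that $(S\setminus\{o\},* )$ is a group.
   Context: A ringoid $(S,+,* )$ is a non-empty set $S$ with two binary operations $+$ and $*$ (with no associativity or commutativity assumed for either operation) such that $a*(b+c)=a*b+a*c$ and $(a+b)*c=a*c+b*c$ for all $a,b,c\in S$. An ideal of $(S,+,* )$ is a non-empty subset $A\subseteq S$ such that $a+b\in A$ for all $a,b\in A$, and $s*a\in A$ and $a*s\in A$ for all $s\in S$, $a\in A$. It is proper if $A\neq S$. The ringoid is ideal-simple if it has no proper ideal $A$ with $|A|\geq 2$. An element $o$ is absorbing in $(S,* )$ if $o*x=o=x*o$ for all $x\in S$. *)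

(* Defs.v *)
From mathcomp Require Import all_boot.
From mathcomp Require Import boolp classical_sets functions cardinality.

Set Implicit Arguments.
Unset Strict Implicit.
Unset Printing Implicit Defensive.

Local Open Scope classical_set_scope.
Local Open Scope card_scope.

Definition is_ringoid (S : Type) (add mul : S -> S -> S) : Prop :=
  [/\ [set: S] !=set0, right_distributive mul add & left_distributive mul add].

Definition is_ideal (S : Type) (add mul : S -> S -> S) (A : set S) : Prop :=
  [/\ A !=set0,
      forall a b, A a -> A b -> A (add a b),
      forall s a, A a -> A (mul s a) &
      forall s a, A a -> A (mul a s)].

(* [`I_2 #<= A] says that [A] has at least two elements. *)
Definition ideal_simple (S : Type) (add mul : S -> S -> S) : Prop :=
  ~ exists A : set S, [/\ is_ideal add mul A, A <> [set: S] & `I_2 #<= A].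

Definition is_absorbing (S : Type) (mul : S -> S -> S) (o : S) : Prop :=
  forall x, mul o x = o /\ mul x o = o.

(* The subset [G] is a group under the restriction of [mul]; the library's
   [groupType] only describes group laws on whole types. *)
Definition is_group (S : Type) (mul : S -> S -> S) (G : set S) : Prop :=
  [/\ forall x y, G x -> G y -> G (mul x y),
      forall x y z, G x -> G y -> G z -> mul x (mul y z) = mul (mul x y) z &
      exists e, [/\ G e,
        forall x, G x -> mul e x = x /\ mul x e = x &
        forall x, G x -> exists y, [/\ G y, mul x y = e & mul y x = e]]].

(* Main.v *)
Require Import Defs.
From mathcomp Require Import all_boot.
From mathcomp Require Import boolp classical_sets functions cardinality.

Local Open Scope classical_set_scope.
Local Open Scope card_scope.

(** Every [S * a] is an ideal, hence is [S] or a singleton. If all of them are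
    [S], then division is always possible and [( S, * )] is a group. If
    [S * a = {o}] for some [a], then [o] is absorbing and the annihilator
    [{x | S * x = {o}}] is again an ideal: it is either [S], so that
    [S * S = {o}], or [{o}], so that [S * x = S] for every [x <> o]. *)

Lemma card_ge2 {T : Type} {A : set T} {x y : T} :
  A x -> A y -> x <> y -> `I_2 #<= A.
Proof.
move=> Ax Ay nxy; pose f n := if n == 0 then x else y.
have finj : {in `I_2 &, injective f}.
  move=> [|[|i]] [|[|j]] /set_mem //= _ /set_mem //= _; rewrite /f /= => exy //.
  by case: nxy.
rewrite -(card_le_eql (inj_card_eq finj)); apply: subset_card_le.
by move=> _ [n _ <-]; rewrite /f; case: ifP.
Qed.

(** A solution [e] of e * a = a for one [a] fixes every element, since each x has the form s * a and
    e * (s * a) = s * (e * a). Inverses are then solutions of y * x = e. *)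
Lemma is_group_div {T : Type} {mul : T -> T -> T} {G : set T} :
    associative mul -> commutative mul -> G !=set0 ->
    (forall x y, G x -> G y -> G (mul x y)) ->
    (forall a x, G a -> G x -> exists2 s, G s & mul s a = x) ->
  is_group mul G.
Proof.
move=> mulA mulC [a Ga] Gmul Gdiv; split=> //; have [e Ge ea] := Gdiv a a Ga Ga.
have e1 x : G x -> mul e x = x.
  by move=> Gx; have [s _ <-] := Gdiv a x Ga Gx; rewrite mulC -mulA (mulC a) ea.
exists e; split=> // x Gx; first by rewrite (mulC x) e1.
by have [y Gy yx] := Gdiv x e Gx Ge; exists y; rewrite mulC yx.
Qed.

(** A second point beside [x] would give a proper ideal two elements. *)
Lemma ideal_simpleP {S : Type} {add mul : S -> S -> S} {A : set S} {x : S} :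
  ideal_simple add mul -> is_ideal add mul A -> A x ->
  A = [set: S] \/ A = [set x].
Proof.
move=> simpleS idA Ax; have [|nAT] := pselect (A = [set: S]); first by left.
right; apply/seteqP; split=> [y Ay|y ->//]; apply: contrapT => nyx.
by apply: simpleS; exists A; split=> //; exact: (card_ge2 Ay Ax nyx).
Qed.

Lemma is_ideal_mulr {S : Type} {add mul : S -> S -> S} (a : S) :
  is_ringoid add mul -> associative mul -> commutative mul ->
  is_ideal add mul (range (mul^~ a)).
Proof.
move=> [_ mulDr mulDl] mulA mulC; split.
- by exists (mul a a), a.
- by move=> _ _ [s _ <-] [t _ <-]; exists (add s t); rewrite ?mulDl.
- by move=> t _ [s _ <-]; exists (mul t s); rewrite ?mulA.
- by move=> t _ [s _ <-]; exists (mul t s); rewrite // (mulC _ t) mulA.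
Qed.

Lemma is_ideal_annihilator {S : Type} {add mul : S -> S -> S} {o : S} :
  is_ringoid add mul -> associative mul -> commutative mul ->
  is_absorbing mul o -> is_ideal add mul [set x | forall s, mul s x = o].
Proof.
move=> [_ mulDr mulDl] mulA mulC oP.
have so s : mul s o = o by have [] := oP s.
split.
- by exists o.
- move=> x y xo yo s; rewrite mulDr xo yo.
  (* Closure under addition needs o + o = o: the sum is rewritten as a multiple of [o], which
     absorption collapses. *)
  have -> : add o o = mul (add o o) o by rewrite mulDl so.
  exact: so.
- by move=> t x xo s; rewrite mulA.
- by move=> t x xo s; rewrite (mulC x) mulA.
Qed.

Theorem proposition2p8 (S : Type) (add mul : S -> S -> S)
    (ringoidS : is_ringoid add mul)
    (mulA : associative mul) (mulC : commutative mul)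
    (simpleS : ideal_simple add mul) :
  [\/ [set mul a b | a in [set: S] & b in [set: S]] #= `I_1,
      is_group mul [set: S] |
      exists o : S, is_absorbing mul o /\ is_group mul ([set: S] `\ o)].
Proof.
have [S0 _ _] := ringoidS.
have Sa a s : range (mul^~ a) = setT \/ range (mul^~ a) = [set mul s a].
  by apply: (ideal_simpleP simpleS); [exact: is_ideal_mulr | exists s].
have [divS|] := pselect (forall a, range (mul^~ a) = [set: S]).
  apply: Or32; apply: is_group_div => // a x _ _.
  by have [s _ <-] : range (mul^~ a) x by [rewrite divS]; exists s.
move=> /existsNP[a naT]; have [//|Sao] := Sa a a.
set o := mul a a in Sao.
have ao s : mul s a = o by have : range (mul^~ a) (mul s a) by [exists s]; rewrite Sao.
(* Since [o] is a * a, s * o = (s * a) * a is again a product with right factor [a]. *)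
have so s : mul s o = o by rewrite /o mulA ao.
have oP : is_absorbing mul o by move=> x; rewrite (mulC o) so.
have := ideal_simpleP simpleS (is_ideal_annihilator ringoidS mulA mulC oP) so.
case=> [annT|anno].
  apply: Or31; suff -> : [set mul x y | x in [set: S] & y in [set: S]] = [set o].
    exact: card_set1.
  apply/seteqP; split=> [_ [x _ [y _ <-]]|_ ->]; last by exists a => //; exists a.
  by have : [set: S] y by []; rewrite -annT; apply.
have divS x y : x <> o -> exists s, mul s x = y.
  (* Taking o * x = o as the known point of S * x makes the singleton case S * x = {o}, which puts
     [x] in the annihilator. *)
  move=> nxo; have [SxT|Sxo] := Sa x o.
    by have [s _ <-] : range (mul^~ x) y by [rewrite SxT]; exists s.
  case: nxo; suff : [set x | forall s, mul s x = o] x by rewrite anno.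
  move=> s; have : range (mul^~ x) (mul s x) by exists s.
  by rewrite Sxo mulC so.
(* If [o] were the only element, S * a = {o} would be all of [S], against the choice of [a]. *)
have [oT|/existsNP[b nbo]] := pselect (forall b, b = o).
  by case: naT; rewrite Sao; apply/seteqP; split=> // x _; rewrite (oT x).
apply: Or33; exists o; split=> //; apply: is_group_div => //.
- by exists b.
- move=> x y [_ nxo] [_ nyo]; split=> // xyo; apply: (nxo).
  (* There are no zero divisors: x = p * y and p = q * x give x = q * (x * y) = q * o = o. *)
  have [p <-] := divS y x nyo; have [q <-] := divS x p nxo.
  by rewrite -mulA xyo so.
- move=> x y [_ nxo] [_ nyo]; have [s sx] := divS x y nxo; exists s => //.
  by split=> // so'; apply: nyo; rewrite -sx so' mulC so.
Qed.
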